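(* Let $d=1$ and $\mathbb{T}=\mathbb{T}^1$. Let $H:\mathbb{T}\times\mathbb{R}\to\mathbb{R}$ be of class $C^1$, with $p\mapsto H(x,p)$ strictly convex for every $x\in\mathbb{T}$, and $\lim_{|p|\to\infty}\inf_{x\in\mathbb{T}}H(x,p)=+\infty$. Let $f:\mathbb{T}\times[0,\infty)\to\mathbb{R}$ be continuous, with $r\mapsto f(x,r)$ strictly increasing for every $x\in\mathbb{T}$, and suppose there is $C>0$ with $|f(x,r)|\le C(1+r^{q-1})$ for all $(x,r)\in\mathbb{T}\times[0,\infty)$. Let $(m,\lambda)$ be an ergodic pair. Then $$|\mathcal{R}_m^{\rm gap}|=0,$$ where $|\cdot|$ denotes Lebesgue measure.
   Context: $\mathbb{T}$ is the one-dimensional flat torus, identified with $[0,1]$. Fix $s>1$, $q>1$ with conjugate exponents $s',q'$, and assume the Sobolev embedding $W^{1,s}(\mathbb{T})\hookrightarrow L^{q'}(\mathbb{T})$. A triple $(u,m,\lambda)\in W^{1,s}(\mathbb{T})\times L^q(\mathbb{T})\times\mathbb{R}$ is a weak solution to the ergodic problem if (i) $m\ge0$ a.e., $\int_{\mathbb{T}}m\,dx=1$ and $mH_p(x,u_x)\in L^{s'}(\mathbb{T})$; (ii) $H(x,u_x)\le f(x,m)+\lambda$ a.e. on $\mathbb{T}$; (iii) $H(x,u_x)=f(x,m)+\lambda$ a.e. on $\{m>0\}$; (iv) $-(mH_p(x,u_x))_x=0$ in $\mathcal{D}'(\mathbb{T})$. For fixed $(m,\lambda)$, $\mathcal{E}(m,\lambda)$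 denotes the set of $u$ such that $(u,m,\lambda)$ is a weak solution. An ergodic pair is a pair $(m,\lambda)\in L^q(\mathbb{T})\times\mathbb{R}$ with $\mathcal{E}(m,\lambda)\neq\emptyset$. Regions: $\mathcal{O}_m$ is the union of all open $U\subset\mathbb{T}$ such that $m=0$ a.e. in $U$. After fixing a measurable representative of $m$, $\mathcal{P}_m:=\{m>0\}\setminus\mathcal{O}_m$ and $\mathcal{R}_m:=\mathbb{T}\setminus(\mathcal{P}_m\cup\mathcal{O}_m)$ (understood up to Lebesgue null sets). With $\ell(x):=\lambda+f(x,0)$ and $\underline{H}(x):=\min_{p\in\mathbb{R}}H(x,p)$, set $\mathcal{R}_m^{\rm gap}:=\mathcal{R}_m\cap\{x:\ell(x)>\underline{H}(x)\}$. *)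

(* Defs.v *)
From mathcomp Require Import all_boot all_order all_algebra.
From mathcomp Require Import all_classical all_reals all_analysis.

Set Implicit Arguments.
Unset Strict Implicit.
Unset Printing Implicit Defensive.
Import Order.TTheory GRing.Theory Num.Theory.
Import numFieldNormedType.Exports.

Local Open Scope classical_set_scope.
Local Open Scope ring_scope.

(* Functions (resp. subsets) of the flat torus T = R/Z are represented by
   their 1-periodic lifts to R.  Integrals, L^p norms, "almost everywhere"
   and |.| on T are taken with respect to Lebesgue measure on the fundamental
   domain [0, 1], i.e. with respect to [torus_measure]. *)

Section torus.
Context {R : realType}.

Definition torus_measure : {measure set (measurableTypeR R) -> \bar R} :=
  mrestr lebesgue_measure (measurable_itv `[0%R, 1%R]).

Definition periodic_set (A : set R) := forall x, A (x + 1) <-> A x.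

(* [Lfun] is the library's set of Borel functions of finite p-norm; every
   class in L^p(T) has such a 1-periodic representative. *)
Definition torus_L (p : R) : set (R -> R) :=
  [set g | periodic g 1 /\ g \in Lfun torus_measure p%:E].

(* C^oo(T) *)
Definition torus_test : set (R -> R) :=
  [set phi | periodic phi 1 /\
     forall n x, derivable (derive1n n phi) x 1].

(* The distributional derivative u_x = v in D'(T). *)
Definition weak_derivative (u v : R -> R) :=
  forall phi, torus_test phi ->
    \int[torus_measure]_x (u x * derive1 phi x) =
    - \int[torus_measure]_x (v x * phi x).

(* u is in W^{1,s}(T), with weak derivative ux (unique up to a.e. equality). *)
Definition torus_W1 (s : R) (u ux : R -> R) :=
  [/\ torus_L s u, torus_L s ux & weak_derivative u ux].

Definition sobolev_embedding (s r : R) :=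
  exists K : R, forall u ux, torus_W1 s u ux ->
    torus_L r u /\
    ('N[torus_measure]_(r%:E)[EFin \o u] <=
     K%:E * ('N[torus_measure]_(s%:E)[EFin \o u] +
             'N[torus_measure]_(s%:E)[EFin \o ux]))%E.

(* The partial derivative H_p(x, p). *)
Definition Hp (H : R -> R -> R) (x p : R) : R := derive1 (H x) p.

Definition class_C1 (H : R -> R -> R) :=
  let G : R * R -> R := fun z => H z.1 z.2 in
  (forall z, differentiable G z) /\
  (forall v, continuous (fun z => 'D_v G z)).

Definition strictly_convex (g : R -> R) :=
  forall p1 p2 t : R, p1 != p2 -> 0 < t < 1 ->
    g (t * p1 + (1 - t) * p2) < t * g p1 + (1 - t) * g p2.

(* inf over x of H(x, p) tends to +oo as |p| -> oo; on the line, |p| -> oo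
   means p -> +oo and p -> -oo. *)
Definition uniformly_coercive (H : R -> R -> R) :=
  let Hinf p : \bar R := ereal_inf (range (fun x => (H x p)%:E)) in
  (Hinf p @[p --> +oo] --> +oo%E) /\ (Hinf p @[p --> -oo] --> +oo%E).

Definition Hamiltonian (H : R -> R -> R) :=
  [/\ forall p, periodic (H ^~ p) 1,
      class_C1 H,
      forall x, strictly_convex (H x)
    & uniformly_coercive H].

(* f is only meaningful on T x [0, +oo): nothing is assumed at r < 0. *)
Definition coupling (q : R) (f : R -> R -> R) :=
  [/\ forall r, 0 <= r -> periodic (f ^~ r) 1,
      {within [set z : R * R | 0 <= z.2], continuous (fun z => f z.1 z.2)},
      forall x r1 r2, 0 <= r1 -> r1 < r2 -> f x r1 < f x r2
    & exists2 C : R, 0 < C &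
        forall x r, 0 <= r -> `|f x r| <= C * (1 + r `^ (q - 1))].

(* s' is the conjugate exponent of s. *)
Definition weak_solution (s s' q : R) (H f : R -> R -> R)
    (u m : R -> R) (lam : R) :=
  torus_L q m /\
  exists2 ux : R -> R, torus_W1 s u ux &
  [/\ [/\ {ae torus_measure, forall x, 0 <= m x},
          \int[torus_measure]_x m x = 1
        & torus_L s' (fun x => m x * Hp H x (ux x))],
      {ae torus_measure, forall x, H x (ux x) <= f x (m x) + lam},
      {ae torus_measure, forall x,
         0 < m x -> H x (ux x) = f x (m x) + lam}
    & forall phi, torus_test phi ->
        \int[torus_measure]_x (m x * Hp H x (ux x) * derive1 phi x) = 0].

Definition ergodic_set (s s' q : R) (H f : R -> R -> R)
    (m : R -> R) (lam : R) : set (R -> R) :=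
  [set u | weak_solution s s' q H f u m lam].

Definition ergodic_pair (s s' q : R) (H f : R -> R -> R)
    (m : R -> R) (lam : R) :=
  torus_L q m /\ ergodic_set s s' q H f m lam !=set0.

Definition region_O (m : R -> R) : set R :=
  \bigcup_(U in [set U : set R | [/\ open U, periodic_set U
      & {ae torus_measure, forall x, U x -> m x = 0}]]) U.

Definition region_P (m : R -> R) : set R :=
  [set x | 0 < m x] `\` region_O m.

Definition region_R (m : R -> R) : set R :=
  ~` (region_P m `|` region_O m).

Definition ell (f : R -> R -> R) (lam x : R) : R := lam + f x 0.

(* The minimum of H(x, .), attained when H(x, .) is continuous and coercive. *)
Definition Hmin (H : R -> R -> R) (x : R) : R := inf (range (H x)).

Definition region_R_gap (H f : R -> R -> R) (m : R -> R) (lam : R) : set R :=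
  region_R m `&` [set x | Hmin H x < ell f lam x].

End torus.

(* Main.v *)
Require Import Defs.
From mathcomp Require Import all_boot all_order all_algebra.
From mathcomp Require Import all_classical all_reals all_analysis.
From mathcomp Require Import measurable_realfun ring lra.
Import Order.TTheory GRing.Theory Num.Theory.
Import numFieldNormedType.Exports.
Local Open Scope classical_set_scope.
Local Open Scope ring_scope.

(** In dimension one the continuity equation says that the flux
    m * H_p(x, u_x) has zero distributional derivative, hence is a.e. equal to
    a constant c ([du_bois_reymond]).

    If c <> 0, then m cannot vanish on a set of positive measure, so m > 0 a.e.
    and the whole region R_m is negligible ([region_R_negligible]).

    If c = 0, then a.e. on {m > 0} the momentum u_x is a critical point of the
    convex function H(x, .), hence a minimiser, and the Hamilton-Jacobi
    equation reads min H(x, .) = f(x, m) + lambda > f(x, 0) + lambda = ell(x)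
    because f(x, .) is strictly increasing
    ([positive_critical_notin_gap]).  So m = 0 a.e. on the gap
    G = {x | min H(x, .) < ell(x)}.  Since G is open ([open_gap_set]), it is
    one of the sets whose union is O_m, and R_m, which avoids O_m, does not
    meet it: the region R_m^gap is even empty.

    The constancy of the flux g is proved with trigonometric polynomials as the
    only test functions.  Each one without constant term is the derivative of
    another, so k = g - int g is orthogonal to all of them
    ([trig_orthogonal]).  They form an algebra, so explicit polynomials in a
    suitable wave, with values in [0, 1], approximate the indicator of [0, b]
    pointwise a.e. on the torus ([cvg_threshold_profile]).  By dominated
    convergence the integral of k over [0, b] vanishes for every b in ]0, 1[
    ([trig_total]), and the Lebesgue differentiation theorem gives k = 0 a.e.
    ([du_bois_reymond_integral0]). *)

(** * Trigonometric polynomials *)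

Section trigonometric_polynomials.
Context {R : realType}.
Implicit Types (a b x : R) (k : int) (p : R -> R).

(** A real phase b, rather than separate sines and cosines, makes products and
    derivatives of waves again sums of waves; integer frequencies of both signs
    avoid comparing frequencies in products. *)
Definition wave a k b : R -> R := fun x => a * cos (2 * pi * k%:~R * x + b).

Inductive trigonometric : (R -> R) -> Prop :=
| trig_wave a k b : trigonometric (wave a k b)
| trigD p1 p2 : trigonometric p1 -> trigonometric p2 ->
    trigonometric (fun x => p1 x + p2 x).

Lemma trig_cst a : trigonometric (fun=> a).
Proof.
have -> : (fun=> a) = wave a 0 0.
  by apply/funext => x; rewrite /wave mulr0 mul0r addr0 cos0 mulr1.
exact: trig_wave.
Qed.

Lemma wave_product a1 k1 b1 a2 k2 b2 x :
  wave a1 k1 b1 x * wave a2 k2 b2 x =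
  wave (a1 * a2 / 2) (k1 + k2) (b1 + b2) x +
  wave (a1 * a2 / 2) (k1 - k2) (b1 - b2) x.
Proof.
rewrite /wave; set u := _ * x + b1; set v := _ * x + b2.
have -> : 2 * pi * (k1 + k2)%:~R * x + (b1 + b2) = u + v.
  by rewrite /u /v intrD; ring.
have -> : 2 * pi * (k1 - k2)%:~R * x + (b1 - b2) = u - v.
  by rewrite /u /v intrB; ring.
by rewrite (cosD u v) (cosB u v); field.
Qed.

Lemma trigM p1 p2 : trigonometric p1 -> trigonometric p2 ->
  trigonometric (fun x => p1 x * p2 x).
Proof.
move=> + t2; elim=> {p1}[a1 k1 b1|p p' _ tp _ tp'].
  elim: t2 => {p2}[a2 k2 b2|p p' _ tp _ tp'].
    under eq_fun do rewrite wave_product.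
    by apply: trigD; exact: trig_wave.
  by under eq_fun do rewrite mulrDr; exact: trigD.
by under eq_fun do rewrite mulrDl; exact: trigD.
Qed.

Lemma trigX p n : trigonometric p -> trigonometric (fun x => p x ^+ n).
Proof.
move=> tp; elim: n => [|n ih]; first exact: trig_cst.
by under eq_fun do rewrite exprS; exact: trigM.
Qed.

Lemma trig1B p : trigonometric p -> trigonometric (fun x => 1 - p x).
Proof.
move=> tp; under eq_fun do rewrite -mulN1r.
by apply: trigD; [exact: trig_cst|apply: trigM => //; exact: trig_cst].
Qed.

Lemma periodic_wave a k b : periodic (wave a k b) 1.
Proof.
move=> x; rewrite /wave; congr (_ * _).
set u := 2 * pi * k%:~R * x + b.
have -> : 2 * pi * k%:~R * (x + 1) + b = u + 2 * pi * k%:~R.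
  by rewrite /u; ring.
case: k {u} (u) => n u.
  by rewrite mulr_natr mulr_natl (periodicn (@cosD2pi _)).
rewrite NegzE mulrNz mulrN.
rewrite -[in RHS](subrK (2 * pi * n.+1%:~R) u) mulr_natr mulr_natl.
by rewrite (periodicn (@cosD2pi _)).
Qed.

Lemma is_derive_wave a k b x :
  is_derive x 1 (wave a k b) (wave (a * (2 * pi * k%:~R)) k (b + pi / 2) x).
Proof.
rewrite /wave addrA cosDpihalf.
apply: is_derive_eq.
rewrite /GRing.scale/=; ring.
Qed.

Lemma trig_continuous p : trigonometric p -> continuous p.
Proof.
elim=> {p}[a k b|p1 p2 _ c1 _ c2] x; last by apply: cvgD; [exact: c1|exact: c2].
apply/differentiable_continuous/derivable1_diffP.
by case: (is_derive_wave a k b x).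
Qed.

Lemma trig_bounded p : trigonometric p -> exists M, forall x, `|p x| <= M.
Proof.
elim=> {p}[a k b|p1 p2 _ [M1 b1] _ [M2 b2]].
  by exists `|a| => x; rewrite normrM ler_piMr// cos_max.
by exists (M1 + M2) => x; rewrite (le_trans (ler_normD _ _))// lerD.
Qed.

Lemma derive1_wave a k b :
  derive1 (wave a k b) = wave (a * (2 * pi * k%:~R)) k (b + pi / 2).
Proof.
by apply/funext => x; rewrite derive1E; case: (is_derive_wave a k b x).
Qed.

Lemma torus_test_wave a k b : torus_test (wave a k b).
Proof.
split=> [|n x]; first exact: periodic_wave.
have [a' [b' ->]] : exists a' b', derive1n n (wave a k b) = wave a' k b'.
  elim: n => [|n [a' [b' ih]]]; first by exists a, b.
  by rewrite derive1nS ih derive1_wave; do 2 eexists; reflexivity.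
by case: (is_derive_wave a' k b' x).
Qed.

(** The zero frequency is the only obstruction to being a derivative. *)
Lemma wave_primitive a k b : k != 0 ->
  exists a' b', wave a k b = derive1 (wave a' k b').
Proof.
move=> k0; exists (a / (2 * pi * k%:~R)), (b - pi / 2).
rewrite derive1_wave subrK mulfVK// mulf_neq0 ?intr_eq0//.
by rewrite mulf_neq0// gt_eqF// pi_gt0.
Qed.

End trigonometric_polynomials.

(** * Integration on the torus *)

Section torus_integration.
Context {R : realType}.
Local Notation mu := (@lebesgue_measure R).
Local Notation tau := (@torus_measure R).

Lemma torus_measureE (A : set R) : tau A = mu (A `&` `[0, 1]).
Proof. by []. Qed.

Lemma torus_measureT : tau setT = 1%E.
Proof.
by rewrite torus_measureE setTI lebesgue_measure_itv/= lte_fin ltr01 sube0.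
Qed.

Lemma torus_negligible_compl : tau (~` `[0, 1]) = 0%E.
Proof. by rewrite torus_measureE setICl measure0. Qed.

(** [torus_measure] is carried by [0, 1], so that integrating against it is
    integrating over [0, 1]; this gives access to the fundamental theorem of
    calculus, which concerns Lebesgue measure. *)
Lemma torus_integralE (f : R -> \bar R) : measurable_fun setT f ->
  (\int[tau]_x f x = \int[mu]_(x in `[0%R, 1%R]) f x)%E.
Proof.
move=> mf; transitivity (\int[tau]_(x in `[0%R, 1%R]) f x)%E.
  rewrite [RHS]integral_mkcond; apply: ae_eq_integral => //.
    by apply/(measurable_restrictT _ _).1 => //; exact: measurable_funS mf.
  exists (~` `[0, 1]); split => //; first exact: measurableC.
    exact: torus_negligible_compl.
  move=> x /= + x01; apply => _.
  by rewrite patchE mem_set.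
apply: eq_measure_integral => A mA A01.
by rewrite torus_measureE setIidl.
Qed.

Lemma torus_integrableE (f : R -> \bar R) : measurable_fun setT f ->
  tau.-integrable setT f <-> mu.-integrable `[0%R, 1%R] f.
Proof.
move=> mf; have maf : measurable_fun setT (fun x => `|f x|%E).
  exact: measurableT_comp.
split=> /integrableP[_ fi]; apply/integrableP; split => //.
- exact: measurable_funS mf.
- by rewrite -torus_integralE.
- by rewrite torus_integralE.
Qed.

Lemma torus_Lfun_integrable (p : R) (g : R -> R) : 1 <= p ->
  g \in Lfun tau p%:E -> tau.-integrable setT (EFin \o g).
Proof.
move=> p1 gp; apply/Lfun1_integrable.
by apply: (Lfun_subset _ _ _ _ gp) => //; rewrite ?lee_fin// torus_measureT.
Qed.

Lemma integrable_mul_trig (k p : R -> R) :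
  tau.-integrable setT (EFin \o k) -> trigonometric p ->
  tau.-integrable setT (EFin \o (fun x => k x * p x)).
Proof.
move=> ik tp; have [M pM] := trig_bounded _ tp.
apply: (@integrableMl _ _ _ tau setT measurableT (EFin \o k) p) => //.
- apply: continuous_measurable_fun; exact: trig_continuous.
- exists M; split=> [|y My x _]; first exact: num_real.
  exact: le_trans (pM x) (ltW My).
Qed.

Lemma integrable_torus_cst (c : R) : tau.-integrable setT (EFin \o cst c).
Proof.
apply/integrableP; split; first exact/measurable_EFinP/measurable_cst.
by rewrite /= integral_cst//= torus_measureT mule1 ltry.
Qed.

Lemma integrable_trig (p : R -> R) : trigonometric p ->
  tau.-integrable setT (EFin \o p).
Proof.
move=> tp; have := integrable_mul_trig _ _ (integrable_torus_cst 1) tp.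
rewrite (_ : (fun x => cst 1 x * p x) = p)//.
by apply/funext => x; rewrite mul1r.
Qed.

(** By periodicity the boundary terms at 0 and 1 cancel. *)
Lemma integral_derive_wave (a : R) (k : int) (b : R) :
  \int[tau]_x derive1 (wave a k b) x = 0.
Proof.
rewrite derive1_wave; set w' := wave _ _ _.
have cw' : continuous w' by apply: trig_continuous; exact: trig_wave.
have cw : continuous (wave a k b) by apply: trig_continuous; exact: trig_wave.
rewrite /Rintegral torus_integralE; last first.
  by apply/measurable_EFinP; apply: continuous_measurable_fun; exact: cw'.
rewrite (@continuous_FTC2 _ _ (wave a k b))//.
- by rewrite -[1%R]add0r periodic_wave subee.
- exact: continuous_subspaceT.
- split.
  + by move=> x _; case: (is_derive_wave a k b x).
  + by apply: cvg_at_right_filter; exact: cw.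
  + by apply: cvg_at_left_filter; exact: cw.
- by move=> x _; rewrite derive1_wave.
Qed.

End torus_integration.

(** * Trigonometric approximation of the indicator of an interval *)

Section threshold.
Context {R : realType}.
Implicit Types (b x y w : R) (n N : nat).

Lemma ler_bernoulli y n : 0 <= 1 + y -> 1 + n%:R * y <= (1 + y) ^+ n.
Proof.
move=> y0; elim: n => [|n ih]; first by rewrite mul0r addr0 expr0.
rewrite exprS; apply: le_trans (ler_wpM2l y0 ih).
have := mulr_ge0 (ler0n R n) (sqr_ge0 y).
by rewrite -natr1; nra.
Qed.

(** These are the polynomials of the elementary proof of the Stone-Weierstrass
    theorem: on [0, 1] they converge to 1 below 1/2 and to 0 above it, because
    the sequence 2 ^ n * w ^ n tends to 0 or to +oo and (1 - y) ^ N behaves like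
    exp(- N * y). *)
Definition threshold n w : R := (1 - w ^+ n) ^+ (2 ^ n).

Lemma threshold_itv n w : 0 <= w <= 1 -> 0 <= threshold n w <= 1.
Proof.
move=> /andP[w0 w1]; have wn1 : w ^+ n <= 1 by exact: exprn_ile1.
have wn0 : 0 <= w ^+ n by exact: exprn_ge0.
by rewrite exprn_ge0 ?subr_ge0//= exprn_ile1 ?subr_ge0// gerBl.
Qed.

(** Bernoulli's inequality bounds the threshold below by 1 - (2 w) ^ n. *)
Lemma cvg_threshold_lt w : 0 <= w -> w < 2^-1 ->
  threshold n w @[n --> \oo] --> (1 : R).
Proof.
move=> w0 w12.
apply: (@squeeze_cvgr _ _ _ _ (fun n => 1 - (2 * w) ^+ n) (fun=> 1)).
- apply: nearW => n; have /andP[_ ->] : 0 <= threshold n w <= 1.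
    by apply: threshold_itv; lra.
  rewrite andbT exprMn -[_ * w ^+ n]opprK -mulrN addrC.
  have wn1 : w ^+ n <= 1 by apply: exprn_ile1; lra.
  rewrite -natrX opprK addrC; apply: ler_bernoulli; lra.
- rewrite -[X in _ --> X]subr0; apply: cvgB; first exact: cvg_cst.
  apply: cvg_expr; rewrite ger0_norm; lra.
- exact: cvg_cst.
Qed.

(** With y = w ^ n and N = 2 ^ n, Bernoulli's inequality for (1 + y) ^ N and
    (1 - y) ^ N * (1 + y) ^ N <= 1 bound the threshold above by
    1 / (N * y) = (2 w) ^ (- n). *)
Lemma cvg_threshold_gt w : 2^-1 < w -> w <= 1 ->
  threshold n w @[n --> \oo] --> (0 : R).
Proof.
move=> w12 w1; have w0 : 0 < w by lra.
apply: (@squeeze_cvgr _ _ _ _ (fun=> 0) (fun n => ((2 * w)^-1) ^+ n)).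
- apply: nearW => n; have /andP[-> _]/= : 0 <= threshold n w <= 1.
    by apply: threshold_itv; lra.
  rewrite exprVn -[leRHS]div1r ler_pdivlMr ?exprn_gt0//; last by lra.
  set y := w ^+ n; have y0 : 0 < y by exact: exprn_gt0.
  have y1 : y <= 1 by apply: exprn_ile1; lra.
  have -> : (2 * w) ^+ n = (2 ^ n)%:R * y by rewrite exprMn natrX.
  apply: (@le_trans _ _ ((1 - y) ^+ (2 ^ n) * (1 + y) ^+ (2 ^ n))).
    rewrite ler_wpM2l ?exprn_ge0 ?subr_ge0//.
    have : 1 + (2 ^ n)%:R * y <= (1 + y) ^+ (2 ^ n).
      by apply: ler_bernoulli; lra.
    lra.
  rewrite -exprMn exprn_ile1//; nra.
- exact: cvg_cst.
- apply: cvg_expr; rewrite ger0_norm ?invr_ge0; last by lra.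
  rewrite invf_lt1; lra.
Qed.

(** On ]0, 1[ the factor sin (pi x) is positive, so the profile lies below the
    critical value 1/2 of [threshold] exactly when x < b; the coefficients keep
    it inside [0, 1]. *)
Definition profile b x : R := 2^-1 - 2^-1 * (sin (pi * x) * sin (pi * (b - x))).

(** The product of sines, each of period 2 in x, is a wave of period 1 up to a
    constant. *)
Lemma profileE b x :
  profile b x = 2^-1 + 4^-1 * cos (pi * b) + wave (- 4^-1) 1 (- (pi * b)) x.
Proof.
rewrite /profile /wave.
(* 2 sin u sin v = cos (u - v) - cos (u + v) with u + v = pi * b. *)
have -> : pi * b = pi * x + pi * (b - x) by ring.
have -> : 2 * pi * 1%:~R * x - (pi * x + pi * (b - x)) = pi * x - pi * (b - x).
  by ring.
by rewrite (cosB (pi * x) (pi * (b - x))) (cosD (pi * x) (pi * (b - x))); field.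
Qed.

Lemma trig_threshold_profile n b :
  trigonometric (fun x => threshold n (profile b x)).
Proof.
apply/trigX/trig1B/trigX.
rewrite -[X in trigonometric X]/(profile b) (funext (profileE b)).
by apply: trigD; [exact: trig_cst|exact: trig_wave].
Qed.

Lemma profile_itv b x : 0 <= profile b x <= 1.
Proof.
have := sin_max (pi * x); have := sin_max (pi * (b - x)).
rewrite /profile; move: (sin _) (sin _) => u v u1 v1.
have : `|v * u| <= 1 by rewrite normrM mulr_ile1.
by rewrite ler_norml; lra.
Qed.

Lemma cvg_threshold_profile b x : 0 < b < 1 -> 0 < x < 1 -> x != b ->
  threshold n (profile b x) @[n --> \oo] --> (\1_`]-oo, b] x : R).
Proof.
move=> /andP[b0 b1] /andP[x0 x1]; have pi0 := pi_gt0 R.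
have sx : 0 < sin (pi * x) by rewrite sin_gt0_pi// mulr_gt0//= gtr_pMr.
have /andP[w0 w1] := profile_itv b x.
case: ltgtP => // xb _; rewrite indicE.
- rewrite mem_set/= ?in_itv/= ?ltW//; apply: cvg_threshold_lt => //.
  have sbx : 0 < sin (pi * (b - x)).
    by rewrite sin_gt0_pi// mulr_gt0 ?subr_gt0//= gtr_pMr//; lra.
  by rewrite /profile; have := mulr_gt0 sx sbx; lra.
- rewrite memNset/= ?in_itv/=; last by apply/negP; rewrite -ltNge.
  apply: cvg_threshold_gt => //.
  have sbx : 0 < sin (pi * (x - b)).
    by rewrite sin_gt0_pi// mulr_gt0 ?subr_gt0//= gtr_pMr//; lra.
  rewrite /profile -(opprB x b) mulrN sinN.
  by have := mulr_gt0 sx sbx; lra.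
Qed.

End threshold.

(** * Periodic functions with zero weak derivative *)

Section du_bois_reymond.
Context {R : realType}.
Local Notation mu := (@lebesgue_measure R).
Local Notation tau := (@torus_measure R).
Implicit Types (g k p : R -> R).

(** A wave is either constant, and then the zero mean of k applies, or the
    derivative of a wave. *)
Lemma trig_orthogonal k p : tau.-integrable setT (EFin \o k) ->
  \int[tau]_x k x = 0 ->
  (forall a j b, \int[tau]_x (k x * derive1 (wave a j b) x) = 0) ->
  trigonometric p -> \int[tau]_x (k x * p x) = 0.
Proof.
move=> ik k0 kphi; elim=> {p}[a j b|p1 p2 t1 ih1 t2 ih2].
  have [->|j0] := eqVneq j 0.
    under eq_Rintegral do rewrite /wave mulr0 mul0r.
    by rewrite RintegralZr// k0 mul0r.
  have [a' [b' ->]] := wave_primitive a j b j0.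
  exact: kphi.
under eq_Rintegral do rewrite mulrDr.
by rewrite RintegralD// ?ih1 ?ih2 ?addr0//; exact: integrable_mul_trig.
Qed.

(** The endpoints 0 and 1 are negligible, so an a.e. property on the torus only
    has to be checked on the open unit interval. *)
Lemma torus_ae (P : R -> Prop) :
  {ae mu, forall x, 0 < x < 1 -> P x} -> {ae tau, forall x, P x}.
Proof.
move=> [A [mA A0 PA]]; exists (A `|` ([set 0] `|` [set 1] `|` ~` `[0, 1])).
have m01 : measurable (A `|` ([set 0] `|` [set 1])).
  by apply: measurableU => //; exact: measurableU.
split.
- by rewrite setUA; apply: measurableU => //; exact: measurableC.
- rewrite setUA null_set_setU//; first exact: measurableC.
    apply/eqP; rewrite eq_le measure_ge0 andbT.
    apply: (@le_trans _ _ (mu (A `|` ([set 0] `|` [set 1])))).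
      by rewrite torus_measureE le_measure ?inE//; exact: measurableI.
    rewrite null_set_setU//; first exact: measurableU.
    by rewrite null_set_setU//; exact: lebesgue_measure_set1.
  exact: torus_negligible_compl.
- move=> x /= nPx; have [x01|x01] := boolP (0 <= x <= 1); last first.
    by right; right => /=; rewrite in_itv/=; exact/negP.
  have [->|x0] := eqVneq x 0; first by right; left; left.
  have [->|x1] := eqVneq x 1; first by right; left; right.
  left; apply: PA => /= Px; apply: nPx; apply: Px.
  by rewrite !lt_neqAle eq_sym x0 x1.
Qed.

(** The functions k * threshold n (profile b) have zero integral, are dominated
    by |k| and converge a.e. to k times the indicator of ]-oo, b]. *)
Lemma trig_total k b : tau.-integrable setT (EFin \o k) ->
  (forall p, trigonometric p -> \int[tau]_x (k x * p x) = 0) ->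
  0 < b < 1 -> \int[tau]_x (k x * \1_`]-oo, b] x) = 0.
Proof.
move=> ik kp b01; have mk := measurable_int _ ik.
pose k_ n x := (k x * threshold n (profile b x))%:E.
pose kb x := (k x * \1_`]-oo, b] x)%:E.
have mk_ n : measurable_fun setT (k_ n).
  apply: (measurable_int tau); apply: integrable_mul_trig => //.
  exact: trig_threshold_profile.
have mkb : measurable_fun setT kb.
  apply/measurable_EFinP/measurable_funM; first exact/measurable_EFinP.
  exact: measurable_indic.
have k_kb : {ae tau, forall x, setT x -> k_ ^~ x @ \oo --> kb x}.
  apply: torus_ae; exists [set b].
  split => //; first exact: lebesgue_measure_set1.
  move=> x; apply: contraPP => /eqP xb; apply => x01 _.
  apply: cvg_EFin; first exact: nearW.
  by apply: cvgM; [exact: cvg_cst|exact: cvg_threshold_profile].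
have k_le : {ae tau, forall x n, setT x -> (`|k_ n x| <= `|(k x)%:E|)%E}.
  apply: aeW => x n _.
  have /andP[t0 t1] := threshold_itv n _ (profile_itv b x).
  by rewrite lee_fin normrM ler_piMr// ger0_norm.
have [_ _] := @dominated_convergence _ (measurableTypeR R) R tau setT
  measurableT k_ kb _ mk_ mkb k_kb (integrable_abse ik) k_le.
have k_0 n : (\int[tau]_x k_ n x = 0)%E.
  rewrite -[LHS]fineK; last first.
    apply: integrable_fin_num => //; apply: integrable_mul_trig => //.
    exact: trig_threshold_profile.
  by congr EFin; apply: kp; exact: trig_threshold_profile.
under eq_fun do rewrite k_0.
move=> /cvg_lim; rewrite lim_cst// => kb0.
by rewrite /Rintegral -kb0.
Qed.

(** Extended by 0 outside [0, 1], k has a primitive which vanishes on ]0, 1[;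
    by Lebesgue's differentiation theorem the derivative of that primitive is k
    almost everywhere. *)
Lemma du_bois_reymond_integral0 k : tau.-integrable setT (EFin \o k) ->
  (forall b, 0 < b < 1 -> \int[tau]_x (k x * \1_`]-oo, b] x) = 0) ->
  {ae tau, forall x, k x = 0}.
Proof.
move=> ik kb; have /measurable_EFinP mk := measurable_int _ ik.
have ik01 : mu.-integrable `[0, 1] (EFin \o k).
  exact: (torus_integrableE _ (measurable_int _ ik)).1 ik.
pose K := k \_ `[0, 1].
have iK : mu.-integrable setT (EFin \o K).
  by rewrite -restrict_EFin; apply: (integrable_mkcond _ _).1.
have K0 b : 0 < b < 1 -> \int[mu]_(t in `]-oo, b]) K t = 0.
  move=> b01; rewrite -(kb b b01) /Rintegral torus_integralE; last first.
    apply/measurable_EFinP/measurable_funM => //; exact: measurable_indic.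
  congr fine; rewrite integral_mkcond [RHS]integral_mkcond.
  apply: eq_integral => x _; rewrite !patchE indicE /K patchE.
  case: (_ \in `]-oo, b]%classic); case: (_ \in `[0, 1]%classic);
    by rewrite ?mulr1 ?mulr0.
have iKy y : mu.-integrable `]-oo, y] (EFin \o K).
  exact: integrableS iK.
have lK : locally_integrable [set: R] K by exact: integrable_locally ik01.
apply: torus_ae; have := FTC1Ny iKy lK; apply: filterS.
  exact: (ae_filter_ringOfSetsType mu).
move=> x [_ FE] x01; move: FE; rewrite /K patchE mem_set => [<-|]; last first.
  by rewrite /= in_itv/=; lra.
rewrite derive1E (near_eq_derive (g := cst 0)) ?derive_cst//.
near=> y; apply: K0; near: y.
exact: near_in_itvoo.
Unshelve. all: by end_near. Qed.

(** The constant is the mean of g: waves have zero-mean derivatives, so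
    subtracting it keeps the orthogonality to those derivatives. *)
Lemma du_bois_reymond g : tau.-integrable setT (EFin \o g) ->
  (forall phi, torus_test phi -> \int[tau]_x (g x * derive1 phi x) = 0) ->
  exists c, {ae tau, forall x, g x = c}.
Proof.
move=> ig gphi; pose c := \int[tau]_x g x; exists c.
have ic : tau.-integrable setT (EFin \o cst c) by exact: integrable_torus_cst.
have igc : tau.-integrable setT (EFin \o (fun x => g x - c)).
  exact: (integrableB measurableT ig ic).
suff : {ae tau, forall x, g x - c = 0}.
  apply: (@filterS _ _ (ae_filter_ringOfSetsType tau)) => x /eqP.
  by rewrite subr_eq0 => /eqP.
apply: du_bois_reymond_integral0 => // b b01; apply: trig_total => // p tp.
apply: trig_orthogonal => // [|a j b'].
  by rewrite RintegralB// Rintegral_cst// torus_measureT mulr1 subrr.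
have tw : trigonometric (derive1 (wave a j b')).
  by rewrite derive1_wave; exact: trig_wave.
under eq_Rintegral do rewrite mulrBl.
rewrite RintegralB//; [|exact: integrable_mul_trig..].
rewrite gphi; last exact: torus_test_wave.
rewrite RintegralZl// ?integral_derive_wave ?mulr0 ?subrr//.
exact: integrable_trig.
Qed.

End du_bois_reymond.

(** * The Hamiltonian and the gap between its minimum and ell *)

Section hamiltonian.
Context {R : realType}.
Implicit Types (H f : R -> R -> R) (x p : R).

(** If h p' < h p, convexity on the segment from p to p' makes the difference
    quotients at p in the direction p' - p at most h p' - h p < 0, so the
    derivative could not vanish. *)
Lemma strictly_convex_critical_min (h : R -> R) p :
  strictly_convex h -> derivable h p 1 -> derive1 h p = 0 ->
  forall p', h p <= h p'.
Proof.
move=> hh /derivable1_diffP dh h'0 p'; rewrite leNgt; apply/negP => hp'.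
have p'p : p' != p by apply: contraTneq hp' => ->; rewrite ltxx.
pose quot t := t^-1 * (h (t * (p' - p) + p) - h p).
have qcvg : quot t @[t --> 0^'+] --> (0 : R).
  apply: cvg_dnbhs_at_right.
  have Dv : 'D_(p' - p) h p = 0.
    rewrite deriveE// -[p' - p]mulr1.
    rewrite [X in 'd h p X](_ : _ = (p' - p) *: (1 : R))//.
    by rewrite linearZ/= -derive1E'// h'0 scaler0.
  by rewrite -[X in _ --> X]Dv; exact: diff_derivable dh.
have qle : \forall t \near 0^'+, quot t <= h p' - h p.
  near=> t; have t01 : 0 < t < 1.
    by apply/andP; split; near: t; [exact: nbhs_right_gt|exact: nbhs_right_lt].
  rewrite /quot ler_pdivrMl; last by case/andP: t01.
  have -> : t * (p' - p) + p = t * p' + (1 - t) * p by ring.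
  have := hh p' p t p'p t01; lra.
have : 0 <= h p' - h p by exact: cvgr_to_le qcvg qle.
by rewrite subr_ge0 leNgt hp'.
Unshelve. all: by end_near. Qed.

Lemma class_C1_differentiable H x p : class_C1 H ->
  differentiable (H x) p /\ differentiable (H ^~ p) x.
Proof.
move=> [dH _]; split.
- exact: (@differentiable_comp _ _ _ _ (fun p => (x, p)) _ p _ (dH (x, p))).
- exact: (@differentiable_comp _ _ _ _ (fun x => (x, p)) _ x _ (dH (x, p))).
Qed.

(** Without a lower bound the infimum defining [Hmin] would be a default value.
    Coercivity bounds H(x, .) below by 0 outside a compact interval, on which
    continuity gives a minimum. *)
Lemma hamiltonian_has_lbound H x : Hamiltonian H -> has_lbound (range (H x)).
Proof.
move=> [_ C1H _ [coe1 coe2]].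
have [M1 [_ HM1]] := cvgey_ge coe1 0.
have [M2 [_ HM2]] := cvgey_ge coe2 0.
have Hinf_le p : (ereal_inf (range (fun x => (H x p)%:E)) <= (H x p)%:E)%E.
  by apply: ereal_inf_lbound; exists x.
(* Taking the minimum with M1 - 1 makes the interval nonempty whatever the
   order of the two thresholds. *)
have ab : Num.min M2 (M1 - 1) <= M1 by rewrite ge_min; apply/orP; right; lra.
have [|c _ cmin] := EVT_min ab (f := H x).
  apply: continuous_subspaceT => p; apply: differentiable_continuous.
  by have [] := class_C1_differentiable H x p C1H.
exists (Num.min 0 (H x c)) => _ [p _ <-]; rewrite ge_min.
have [pM1|M1p] := leP p M1; last first.
  by apply/orP; left; rewrite -lee_fin (le_trans (HM1 _ M1p)).
have [M2p|pM2] := leP M2 p; last first.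
  by apply/orP; left; rewrite -lee_fin (le_trans (HM2 _ pM2)).
by apply/orP; right; apply: cmin; rewrite in_itv/= ge_min M2p pM1.
Qed.

Lemma Hmin_le H x p : Hamiltonian H -> Hmin H x <= H x p.
Proof.
by move=> HH; apply: ge_inf; [exact: hamiltonian_has_lbound|exists p].
Qed.

(** Applied with p = u_x(x): where the flux vanishes and m > 0, the momentum is
    the minimiser of H(x, .). *)
Lemma Hmin_critical H x p : Hamiltonian H -> Hp H x p = 0 -> Hmin H x = H x p.
Proof.
move=> HH Hp0; apply/eqP; rewrite eq_le Hmin_le//=.
have [_ C1H scH _] := HH.
apply: lb_le_inf; first by exists (H x p), p.
move=> _ [p' _ <-]; apply: strictly_convex_critical_min => //.
by apply/derivable1_diffP; have [] := class_C1_differentiable H x p C1H.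
Qed.

(** The restriction of f to r >= 0 is continuous, and x |-> (x, 0) takes its
    values in that half-plane. *)
Lemma continuous_ell q f lam : coupling q f -> continuous (ell f lam).
Proof.
move=> [_ cf _ _] x; apply: cvgD; first exact: cvg_cst.
move/subspace_continuousP : cf => /(_ (x, 0) (lexx _)).
apply: (@cvg_comp _ _ _ (fun y => (y, 0 : R)) (fun z => f z.1 z.2)) => P /= Pw.
have cx0 : {for x, continuous (fun y : R => (y, 0 : R))}.
  exact: (@cvg_pair _ _ _ (nbhs x) _ _ _ _ _ id (cst 0) cvg_id (cvg_cst _)).
have := cx0 _ Pw; apply: (@filterS _ (nbhs x)) => y; apply; exact: lexx.
Qed.

Definition gap_set H f lam : set R := [set x | Hmin H x < ell f lam x].

(** G is the union over p of the sets {x | H(x, p) < ell(x)}, each of them open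
    because H(., p) and ell are continuous. *)
Lemma open_gap_set q H f lam : Hamiltonian H -> coupling q f ->
  open (gap_set H f lam).
Proof.
move=> HH Hf; have [_ C1H _ _] := HH.
have -> : gap_set H f lam =
    \bigcup_p [set x | (fun x => ell f lam x - H x p) x > 0].
  apply/seteqP; split=> x /=.
  - move=> /inf_lt[]; first by exists (H x 0), 0.
    by move=> _ [p _ <-] xp; exists p => //=; rewrite subr_gt0.
  - move=> [p _ /=]; rewrite subr_gt0; apply: le_lt_trans; exact: Hmin_le.
apply: bigcup_open => p _.
apply: (@open_comp _ _ (fun x => ell f lam x - H x p) [set y | 0 < y]).
  move=> x _; apply: cvgB; first exact: continuous_ell Hf x.
  apply: differentiable_continuous.
  by have [] := class_C1_differentiable H x p C1H.
exact: open_gt.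
Qed.

Lemma periodic_gap_set q H f lam : Hamiltonian H -> coupling q f ->
  periodic_set (gap_set H f lam).
Proof.
move=> [perH _ _ _] [perf _ _ _] x; rewrite /gap_set/= /Hmin /ell perf//.
by rewrite (_ : H (x + 1) = H x)//; apply/funext => p; exact: perH.
Qed.

End hamiltonian.

(** * The regions of the density *)

Section regions.
Context {R : realType}.
Local Notation tau := (@torus_measure R).
Implicit Types (m : R -> R) (H f : R -> R -> R).

Lemma open_region_O m : open (region_O m).
Proof. by apply: bigcup_open => U []. Qed.

Lemma measurable_region_R m : measurable_fun setT m ->
  measurable (region_R m : set (measurableTypeR R)).
Proof.
move=> mm; apply: measurableC; apply: measurableU; last first.
  by apply: open_measurable; exact: open_region_O.
apply: measurableD; last by apply: open_measurable; exact: open_region_O.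
rewrite -[X in measurable X]setTI.
rewrite (_ : [set x | 0 < m x] = m @^-1` `]0, +oo[); first exact: mm.
by apply/seteqP; split => x /=; rewrite in_itv/= andbT.
Qed.

(** Up to a null set every point then lies in {m > 0}, hence in P_m or O_m. *)
Lemma region_R_negligible m : {ae tau, forall x, 0 < m x} ->
  tau.-negligible (region_R m).
Proof.
move=> [A [mA A0 mpos]]; exists A; split => // x Rx; apply: mpos => /= mx.
by apply: Rx; have [?|?] := pselect (region_O m x); [right|left].
Qed.

Lemma vanishing_sub_region_O m (G : set R) : open G -> periodic_set G ->
  {ae tau, forall x, G x -> m x = 0} -> G `<=` region_O m.
Proof. by move=> oG pG mG x Gx; exists G. Qed.

(** Here H(x, p) is the minimum of H(x, .) and equals
    f(x, r) + lambda > ell(x). *)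
Lemma positive_critical_notin_gap q H f (lam r p x : R) :
  Hamiltonian H -> coupling q f -> 0 < r ->
  Hp H x p = 0 -> H x p = f x r + lam -> ~ gap_set H f lam x.
Proof.
move=> HH [_ _ finc _] r0 Hp0 Heq.
rewrite /gap_set /ell/= (Hmin_critical _ _ _ HH Hp0) Heq.
by have := finc x 0 r (lexx 0) r0 => f0r /ltW; rewrite addrC lerD2l leNgt f0r.
Qed.

End regions.

Theorem proposition4p3 (R : realType) (s s' q q' : R)
    (s_gt1 : 1 < s) (q_gt1 : 1 < q)
    (conj_s : s^-1 + s'^-1 = 1) (conj_q : q^-1 + q'^-1 = 1)
    (embedding : sobolev_embedding s q')
    (H f : R -> R -> R) (HH : Hamiltonian H) (Hf : coupling q f)
    (m : R -> R) (lam : R) (ergodic : ergodic_pair s s' q H f m lam) :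
  torus_measure (region_R_gap H f m lam) = 0%E.
Proof.
have [[_ mL] [u [_ [ux _ [[m_ge0 _ [_ fluxL]] _ HJ flux_test]]]]] := ergodic.
have s'_ge1 : 1 <= s'.
  have s0 : 0 < s^-1 by rewrite invr_gt0; lra.
  have s1 : s^-1 < 1 by rewrite invf_lt1; lra.
  have s'0 : 0 < s' by rewrite -invr_gt0; lra.
  rewrite -[s']invrK invf_ge1; [lra|rewrite invr_gt0; lra].
have mm : measurable_fun setT m by move: mL; rewrite inE => /andP[/[!inE]].
have ae_filter := ae_filter_ringOfSetsType (@torus_measure R).
have flux_int := torus_Lfun_integrable _ _ s'_ge1 fluxL.
have [c flux_cst] := du_bois_reymond _ flux_int flux_test.
apply: measure_negligible.
  apply: measurableI; first exact: measurable_region_R.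
  by apply: open_measurable; exact: open_gap_set Hf.
have [c0|c_neq0] := eqVneq c 0; last first.
  have RmR : region_R_gap H f m lam `<=` region_R m by move=> x [].
  apply: (@negligibleS _ (measurableTypeR R) R (@torus_measure R) _ _ RmR).
  apply: region_R_negligible.
  apply: filterS2 m_ge0 flux_cst => x mx_ge0 mHp.
  rewrite lt_neqAle mx_ge0 andbT; apply: contra_neq c_neq0 => mx0.
  by rewrite -mHp -mx0 mul0r.
rewrite (_ : region_R_gap H f m lam = set0); first exact: negligible_set0.
rewrite -subset0 => x [Rx Gx]; apply: Rx; right.
apply: (@vanishing_sub_region_O _ _ (gap_set H f lam)) Gx.
- exact: open_gap_set Hf.
- exact: periodic_gap_set Hf.
- apply: filterS3 m_ge0 HJ flux_cst => y mx_ge0 HJx.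
  rewrite c0 => /eqP; rewrite mulf_eq0 => /orP[/eqP//|/eqP Hp0 Gx].
  apply/eqP; rewrite eq_le mx_ge0 andbT leNgt; apply/negP => mx0.
  exact: (positive_critical_notin_gap _ _ _ _ _ _ _ HH Hf mx0 Hp0 (HJx mx0)).
Qed.
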